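(* Let $d\in\mathbb{N}$ and suppose that $\mathcal{L} \subseteq \mathbb{R}^{2d}$ satisfies one of the following two conditions: (1) $\mathcal{L} = S(\mathbb{R}^d \times \Lambda) = \{ S(x,\lambda) : x \in \mathbb{R}^d, \lambda \in \Lambda \}$ for some symplectic matrix $S\in \mathrm{Sp}_{2d}(\mathbb{R})$ and some lattice $\Lambda \subseteq \mathbb{R}^d$; (2) $\mathcal{L} = L\mathbb{Z}^{2d}$ for some $L \in \mathrm{GL}_{2d}(\mathbb{R})$ which factors as $L=ST$ with $S\in \mathrm{Sp}_{2d}(\mathbb{R})$ and $T = \begin{pmatrix} A & 0 \\ 0 & B \end{pmatrix}$ with $A,B \in \mathrm{GL}_d(\mathbb{R})$. Then for every window function $g \in L^2(\mathbb{R}^d)$ there exist $f_1,f_2 \in L^2(\mathbb{R}^d)$ such that $|V_g f_1(z)| = |V_g f_2(z)|$ for all $z \in \mathcal{L}$, and there is no $\nu\in\mathbb{C}$ with $|\nu|=1$ and $f_1=\nu f_2$.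
   Context: For $f,g\in L^2(\mathbb{R}^d)$ the short-time Fourier transform is $V_gf(x,\omega)=\int_{\mathbb{R}^d} f(t)\overline{g(t-x)}e^{-2\pi i \omega\cdot t}\,dt$, $x,\omega\in\mathbb{R}^d$. A lattice in $\mathbb{R}^n$ is a set $M\mathbb{Z}^n$ with $M\in\mathrm{GL}_n(\mathbb{R})$. With $\mathcal{J}=\begin{pmatrix}0&-I_d\\ I_d&0\end{pmatrix}$, $\mathrm{Sp}_{2d}(\mathbb{R})=\{S\in\mathrm{GL}_{2d}(\mathbb{R}): S^T\mathcal{J}S=\mathcal{J}\}$. *)

(* Defs.v *)
From HB Require Import structures.
From mathcomp Require Import all_boot all_order all_algebra.
From mathcomp Require Import all_classical all_reals.
From mathcomp Require Import ereal topology normedtype sequences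
  measure lebesgue_measure lebesgue_integral trigo.
From mathcomp Require Import complex.

Set Implicit Arguments.
Unset Strict Implicit.
Unset Printing Implicit Defensive.

Import Order.TTheory GRing.Theory Num.Theory.
Local Open Scope classical_set_scope.
Local Open Scope ring_scope.

Section Defs.
Variable R : realType.

Definition Jmx (d : nat) : 'M[R]_(d + d) :=
  block_mx 0 (- 1%:M) 1%:M 0.

Definition symplectic (d : nat) (S : 'M[R]_(d + d)) : Prop :=
  S \in unitmx /\ S^T *m Jmx d *m S = Jmx d.

Definition intvec (n : nat) (k : 'cV[int]_n) : 'cV[R]_n :=
  map_mx (fun z : int => z%:~R) k.

Definition latt (n : nat) (M : 'M[R]_n) : set 'cV[R]_n :=
  [set M *m intvec k | k in [set: 'cV[int]_n]].

Definition is_lattice (n : nat) (Lam : set 'cV[R]_n) : Prop :=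
  exists2 M : 'M[R]_n, M \in unitmx & Lam = latt M.

Definition vec_of_tuple (n : nat) (t : n.-tuple R) : 'cV[R]_n :=
  \col_i tnth t i.

(* Borel measurability of a real function on R^n (R^n carries the product
   sigma-algebra of n.-tuple R, i.e. the Borel sigma-algebra). *)
Definition meas_Rn (n : nat) (F : 'cV[R]_n -> R) : Prop :=
  measurable_fun [set: n.-tuple R] (F \o @vec_of_tuple n).

(* Lebesgue integral over R^n, computed as the iterated integral over the
   coordinates (equal to the n-dimensional Lebesgue integral by
   Fubini-Tonelli for the integrands used below). *)
Fixpoint iint (n : nat) : ('cV[R]_n -> \bar R) -> \bar R :=
  match n with
  | 0 => fun F => F 0
  | n'.+1 => fun F =>
      (\int[@lebesgue_measure R]_t iint (fun v : 'cV[R]_n' => F (col_mx t%:M v)))%E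
  end.

Definition sqnorm (z : R[i]) : R := complex.Re z ^+ 2 + complex.Im z ^+ 2.

Definition cmeasurable (n : nat) (f : 'cV[R]_n -> R[i]) : Prop :=
  meas_Rn (fun t => complex.Re (f t)) /\ meas_Rn (fun t => complex.Im (f t)).

Definition L2 (n : nat) (f : 'cV[R]_n -> R[i]) : Prop :=
  cmeasurable f /\ (iint (fun t => (sqnorm (f t))%:E) < +oo)%E.

Definition L2_eq (n : nat) (f1 f2 : 'cV[R]_n -> R[i]) : Prop :=
  iint (fun t => (sqnorm (f1 t - f2 t))%:E) = 0%E.

Definition cint (n : nat) (h : 'cV[R]_n -> R[i]) : R[i] :=
  (fine (iint (fun t => (complex.Re (h t))%:E)) +i*
   fine (iint (fun t => (complex.Im (h t))%:E)))%C.

Definition expi (theta : R) : R[i] := (cos theta +i* sin theta)%C.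

Definition dotv (n : nat) (u v : 'cV[R]_n) : R := \sum_i u i 0 * v i 0.

Definition stft (d : nat) (g f : 'cV[R]_d -> R[i]) (x w : 'cV[R]_d) : R[i] :=
  cint (fun t => f t * conjc (g (t - x)) * expi (- (2 * pi) * dotv w t)).

Definition stftz (d : nat) (g f : 'cV[R]_d -> R[i]) (z : 'cV[R]_(d + d)) : R[i] :=
  stft g f (usubmx z) (dsubmx z).

End Defs.

(* Main.v *)
(** A reflected window turns the short-time Fourier transform into a Wigner
    distribution, which is real up to an explicit phase.  Let
    phi(t) = g(-t) and let phi' be its symmetric time-frequency shift by p, i.e.
    phi'(t) = exp(i pi (2 eta.t - eta.u)) g(u - t) with p = (u, eta).  The
    substitution t -> u + x - t gives, for z = (x, w),
      conj (V_g phi'(z)) = exp(2 pi i (w.x - [z, p])) V_g phi'(z),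
    where [z, p] = eta.x - w.u is the symplectic form.  If [z, p] is an integer for
    all z in L, then V_g phi(z) and V_g phi'(z) have the same phase modulo pi, so
    phi + i phi' and phi - i phi' have the same |V_g| on L.  Since symplectic
    matrices preserve [ , ], such a p <> 0 is S (m, 0) with m in the dual of the
    lattice in the second factor; no metaplectic operators are needed.
    If phi + i phi' = nu (phi - i phi'), then comparing norms gives
    |phi| = |phi'| almost everywhere; for u <> 0 this makes |phi|^2 periodic and
    integrable, hence zero, and for u = 0 it confines phi to countably many
    hyperplanes.  When g = 0 every pair has the same transform. *)
Require Import Defs.
From HB Require Import structures.
From mathcomp Require Import all_boot all_order all_algebra.
From mathcomp Require Import all_classical all_reals.
From mathcomp Require Import ereal topology normedtype sequences
  measure lebesgue_measure lebesgue_integral trigo.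
From mathcomp Require Import complex.
From mathcomp Require Import ring lra.
From mathcomp Require Import numfun measurable_realfun.
Import Order.TTheory GRing.Theory Num.Theory.
Import numFieldNormedType.Exports.
Local Open Scope classical_set_scope.
Local Open Scope ring_scope.

(** * Iterated Lebesgue integrals *)

Section IteratedIntegral.
Set Implicit Arguments.
Unset Strict Implicit.
Context {R : realType}.
Local Notation mu := (@lebesgue_measure R).
Local Open Scope ereal_scope.

Definition emeas (n : nat) (F : 'cV[R]_n -> \bar R) : Prop :=
  measurable_fun [set: n.-tuple R] (F \o @vec_of_tuple R n).

Lemma vec_of_tuple_cons n (t : R) (v : n.-tuple R) :
  vec_of_tuple [the n.+1.-tuple R of t :: v] =
  (col_mx t%:M (vec_of_tuple v) : 'cV[R]_n.+1).
Proof.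
apply/matrixP => i j; rewrite !mxE ord1 {j}; case: splitP => k.
- rewrite ord1 !mxE eqxx mulr1n => ik.
  have -> : i = ord0 by apply/val_inj.
  by rewrite tnth0.
- move=> ik; rewrite !mxE.
  have -> : i = lift ord0 k by apply/val_inj; rewrite /= ik.
  by rewrite tnthS.
Qed.

(** The parameter space is generalised so that the induction can move one coordinate at a time from
    the vector into it. Positive and negative parts are handled separately, so Tonelli gives
    measurability with no integrability assumption. *)
Lemma measurable_iint d (T : measurableType d) n (F : T -> 'cV[R]_n -> \bar R) :
  measurable_fun [set: T * n.-tuple R] (fun p => F p.1 (vec_of_tuple p.2)) ->
  measurable_fun [set: T] (fun p => iint (F p)).
Proof.
elim: n d T F => [|n IH] d T F mF /=.
  have -> : (fun p => F p 0%R) =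
      (fun q => F q.1 (vec_of_tuple q.2)) \o (fun p : T => (p, [tuple])).
    apply/funext => p /=; congr (F p _).
    by apply/matrixP => -[].
  by apply: measurableT_comp => //; exact: measurable_pair1.
pose H := fun q : T * R =>
  iint (fun v : 'cV[R]_n => F q.1 (col_mx q.2%:M v)).
have mH : measurable_fun [set: T * (measurableTypeR R)] H.
  apply: (IH _ (T * (measurableTypeR R))%type
     (fun q v => F q.1 (col_mx q.2%:M v : 'cV[R]_n.+1))).
  rewrite [X in measurable_fun _ X](_ : _ =
     (fun p => F p.1 (vec_of_tuple p.2)) \o
     (fun w : (T * measurableTypeR R) * n.-tuple R =>
        (w.1.1, [the n.+1.-tuple R of w.1.2 :: w.2]))).
    apply: measurableT_comp => //.
    apply: measurable_fun_pair => /=.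
      exact: measurableT_comp.
    apply: measurable_cons => //; exact: measurableT_comp.
  by apply/funext => w /=; rewrite vec_of_tuple_cons.
rewrite [X in measurable_fun _ X](_ : _ =
  (fun p : T => \int[mu]_t H^\+ (p, t)) \- (fun p : T => \int[mu]_t H^\- (p, t))).
  by apply: emeasurable_funB;
    [apply: (measurable_fun_fubini_tonelli_F (m2 := mu) (H^\+)) => //;
       exact: measurable_funepos
    |apply: (measurable_fun_fubini_tonelli_F (m2 := mu) (H^\-)) => //;
       exact: measurable_funeneg].
apply/funext => p; rewrite /= [LHS]integralE.
by congr (_ - _); apply: eq_integral => t _; rewrite ?funeposE ?funenegE.
Qed.

Lemma emeas_col_mx n (F : 'cV[R]_n.+1 -> \bar R) : emeas F ->
  measurable_fun [set: measurableTypeR R * n.-tuple R]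
    (fun p => F (col_mx p.1%:M (vec_of_tuple p.2))).
Proof.
move=> mF.
rewrite [X in measurable_fun _ X](_ : _ =
   (F \o @vec_of_tuple R n.+1) \o
   (fun w : measurableTypeR R * n.-tuple R => [the n.+1.-tuple R of w.1 :: w.2])).
  apply: measurableT_comp => //.
  by apply: measurable_cons.
by apply/funext => w /=; rewrite vec_of_tuple_cons.
Qed.

Lemma measurable_iint_col_mx n (F : 'cV[R]_n.+1 -> \bar R) : emeas F ->
  measurable_fun [set: measurableTypeR R]
    (fun t : R => iint (fun v : 'cV[R]_n => F (col_mx t%:M v))).
Proof.
move=> /emeas_col_mx mF.
exact: (@measurable_iint _ (measurableTypeR R) n (fun t v => F (col_mx t%:M v))).
Qed.

Lemma emeas_section n (F : 'cV[R]_n.+1 -> \bar R) (t : R) : emeas F ->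
  emeas (fun v : 'cV[R]_n => F (col_mx t%:M v)).
Proof.
move=> /emeas_col_mx mF; rewrite /emeas.
have := measurableT_comp mF (measurable_pair1 (t : measurableTypeR R) (T2 := n.-tuple R)).
exact.
Qed.

Lemma emeas_abs n (F : 'cV[R]_n -> \bar R) : emeas F -> emeas (fun v => `|F v|).
Proof.
move=> mF; rewrite /emeas.
exact: (measurableT_comp (@abse_measurable R setT) mF).
Qed.

Lemma iint_ge0 n (F : 'cV[R]_n -> \bar R) : (forall v, 0 <= F v) -> 0 <= iint F.
Proof.
elim: n F => [|n IH] F F0 /=; first exact: F0.
by apply: integral_ge0 => t _; exact: IH.
Qed.

Lemma iint_cst0 n : iint (fun _ : 'cV[R]_n => 0) = 0 :> \bar R.
Proof.
elim: n => [//|n IH] /=.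
under eq_integral do rewrite IH.
exact: integral0.
Qed.

Lemma ge0_le_iint n (F G : 'cV[R]_n -> \bar R) :
  emeas F -> emeas G -> (forall v, 0 <= F v) -> (forall v, F v <= G v) ->
  iint F <= iint G.
Proof.
elim: n F G => [|n IH] F G mF mG F0 FG /=; first exact: FG.
apply: ge0_le_integral => //.
- by move=> t _; apply: iint_ge0.
- exact: measurable_iint_col_mx.
- exact: measurable_iint_col_mx.
- by move=> t _; apply: IH => //; exact: emeas_section.
Qed.

Lemma le_abse_iint n (F : 'cV[R]_n -> \bar R) :
  emeas F -> `|iint F| <= iint (fun v => `|F v|).
Proof.
elim: n F => [//|n IH] F mF /=.
have mI := measurable_iint_col_mx mF.
apply: (le_trans (le_abse_integral _ measurableT mI)).
apply: ge0_le_integral => //.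
- exact: (measurableT_comp (@abse_measurable R setT) mI).
- exact: (measurable_iint_col_mx (emeas_abs mF)).
- by move=> t _; apply: IH; exact: emeas_section.
Qed.

Definition eintegrable n (F : 'cV[R]_n -> \bar R) : Prop :=
  emeas F /\ iint (fun v => `|F v|) < +oo.

Lemma eintegrable_fin_num n (F : 'cV[R]_n -> \bar R) :
  eintegrable F -> iint F \is a fin_num.
Proof.
move=> [mF Foo]; rewrite fin_num_abs.
exact: le_lt_trans (le_abse_iint mF) Foo.
Qed.

Lemma eintegrable_outer n (F : 'cV[R]_n.+1 -> \bar R) : eintegrable F ->
  mu.-integrable setT (fun t : R => iint (fun v : 'cV[R]_n => F (col_mx t%:M v))).
Proof.
move=> [mF Foo].
have mI := measurable_iint_col_mx mF.
have mA := measurable_iint_col_mx (emeas_abs mF).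
apply: (@le_integrable _ (measurableTypeR R) R mu setT measurableT _
  (fun t : R => iint (fun v : 'cV[R]_n => `|F (col_mx t%:M v)|))) => //.
- move=> t _; rewrite [leRHS]gee0_abs ?iint_ge0//.
  by apply: le_abse_iint; exact: emeas_section.
- apply/integrableP; split => //.
  by under eq_integral do rewrite gee0_abs ?iint_ge0//.
Qed.

(** The inner integral of the absolute value is integrable in the first coordinate, hence finite
    almost everywhere. *)
Lemma ae_eintegrable_section n (F : 'cV[R]_n.+1 -> \bar R) : eintegrable F ->
  {ae mu, forall t : R, eintegrable (fun v : 'cV[R]_n => F (col_mx t%:M v))}.
Proof.
move=> [mF Foo].
have mA := measurable_iint_col_mx (emeas_abs mF).
have /integrable_ae : mu.-integrable setT
  (fun t : R => iint (fun v : 'cV[R]_n => `|F (col_mx t%:M v)|)).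
  apply/integrableP; split => //.
  by under eq_integral do rewrite gee0_abs ?iint_ge0//.
move=> /(_ measurableT); apply: filterS => t /(_ I) Ft.
by split; [exact: emeas_section|rewrite ltey_eq Ft].
Qed.

Lemma emeas_lin n (F G : 'cV[R]_n -> \bar R) (a b : R) :
  emeas F -> emeas G -> emeas (fun v => a%:E * F v + b%:E * G v).
Proof.
move=> mF mG; rewrite /emeas.
by apply: emeasurable_funD; exact: measurable_funeM.
Qed.

(** Linearity of the inner integral is available only at those [t] where both sections are
    integrable. This is almost every [t], which is enough for the outer integral. *)
Lemma iint_lin n (F G : 'cV[R]_n -> \bar R) (a b : R) :
  eintegrable F -> eintegrable G ->
  iint (fun v => a%:E * F v + b%:E * G v) = a%:E * iint F + b%:E * iint G.
Proof.
elim: n F G => [//|n IH] F G iF iG /=.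
have oF := eintegrable_outer iF.
have oG := eintegrable_outer iG.
rewrite -!integralZl// -integralD//; [|exact: integrableZl..].
apply: ae_eq_integral => //.
- apply: (measurable_iint_col_mx (F := fun v => a%:E * F v + b%:E * G v)).
  by apply: emeas_lin; [exact: iF.1|exact: iG.1].
- by apply: emeasurable_funD; apply: measurable_funeM; apply: measurable_iint_col_mx;
   [exact: iF.1|exact: iG.1].
- apply: (@filterS2 _ _ (ae_filter_ringOfSetsType mu) _ _ _ _
    (ae_eintegrable_section iF) (ae_eintegrable_section iG)) => t iFt iGt _.
  exact: IH.
Qed.

(* Almost-everywhere equality is expressed by a nonnegative D with integral zero
   that vanishes only where F = G. *)
Lemma eq_iint_off_null n (D F G : 'cV[R]_n -> \bar R) :
  emeas D -> (forall v, 0 <= D v) -> iint D = 0 -> emeas F -> emeas G ->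
  (forall v, D v = 0 -> F v = G v) -> iint F = iint G.
Proof.
elim: n D F G => [|n IH] D F G mD D0 /= iD mF mG FG; first exact: FG.
have mID := measurable_iint_col_mx mD.
apply: ae_eq_integral => //; [exact: measurable_iint_col_mx..|].
have /ae_eq_integral_abs : \int[mu]_t
   `|iint (fun v : 'cV[R]_n => D (col_mx t%:M v))| = 0.
  by under eq_integral do rewrite gee0_abs ?iint_ge0//.
move=> /(_ measurableT mID); apply: filterS => t /(_ I) /= Dt _.
by apply: (IH (fun v => D (col_mx t%:M v))) => //; try exact: emeas_section;
  move=> v; exact: FG.
Qed.

(** Lebesgue measure is determined by its values on half-open intervals, so it equals its image
    under the reflection. Equality of integrals follows for nonnegative functions, then by positive
    and negative parts. *)
Lemma integral_reflection (a : R) (f : R -> \bar R) :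
  measurable_fun setT f -> \int[mu]_t f (a - t)%R = \int[mu]_t f t.
Proof.
move=> mf.
have mr : measurable_fun [set: measurableTypeR R]
    ((fun t => a - t)%R : R -> measurableTypeR R).
  by apply: measurable_funB.
have pushE A : measurable A -> pushforward mu (fun t => a - t)%R A = mu A.
  move=> mA; apply/esym.
  pose phi : {mfun measurableTypeR R >-> measurableTypeR R} :=
    HB.pack (fun t => a - t)%R (isMeasurableFun.Build _ _ _ _ _ mr).
  apply: (lebesgue_measure_unique (mu := pushforward mu phi)) => // _ [[x y]] _ <-.
  (* The preimage of an interval open on the left is open on the right; both have the same
     length. *)
  transitivity (mu `[(a - y)%R, (a - x)%R[%classic); last first.
    congr (mu _); apply/seteqP; split => t /=; rewrite !in_itv/= => /andP[? ?];
    by apply/andP; split; lra.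
  rewrite !lebesgue_measure_itv/= !lte_fin ltrD2l ltrN2.
  by case: ifPn => // _; rewrite -!EFinD; congr (_%:E); lra.
have ge0 (h : R -> \bar R) : measurable_fun setT h -> (forall t, 0 <= h t) ->
    \int[mu]_t h (a - t)%R = \int[mu]_t h t.
  move=> mh h0.
  have := @ge0_integral_pushforward _ _ _ _ R _ mr mu setT h
    measurableT mh (fun t _ => h0 t).
  rewrite preimage_setT => <-.
  by apply: eq_measure_integral => A mA _; exact: pushE.
rewrite integralE [RHS]integralE; congr (_ - _).
- rewrite -(ge0 (f^\+)) //; last exact: measurable_funepos.
  by apply: eq_integral => t _; rewrite !funeposE.
- rewrite -(ge0 (f^\-)) //; last exact: measurable_funeneg.
  by apply: eq_integral => t _; rewrite !funenegE.
Qed.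

Lemma iint_reflection n (a : 'cV[R]_n) (F : 'cV[R]_n -> \bar R) :
  emeas F -> iint (fun v => F (a - v)%R) = iint F.
Proof.
elim: n a F => [|n IH] a F mF /=.
  by congr (F _); apply/matrixP => -[].
(* The dimension is retyped as [1 + n] so that block operations split off the first coordinate. *)
pose a' : 'cV[R]_(1 + n) := a.
rewrite -(integral_reflection (a' 0 0)%R (measurable_iint_col_mx mF)).
apply: eq_integral => t _.
rewrite -(IH (dsubmx a') _ (emeas_section _ mF)).
congr iint; apply/funext => v; congr (F _).
suff E : (a' - col_mx t%:M v)%R =
    col_mx (a' 0 0 - t)%:M%R (dsubmx a' - v)%R :> 'cV[R]_(1 + n).
  by move: E; rewrite /a' => <-.
rewrite -[X in (X - _)%R](vsubmxK a') opp_col_mx add_col_mx.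
congr col_mx; apply/matrixP => i j; rewrite !ord1 !mxE eqxx !mulr1n.
by congr (a' _ _ - _)%R; apply/val_inj.
Qed.

End IteratedIntegral.

(** * Measurable, integrable and square-integrable functions *)

Section ComplexIntegral.
Set Implicit Arguments.
Unset Strict Implicit.
Context {R : realType}.
Local Notation Re := complex.Re.
Local Notation Im := complex.Im.

Lemma emeas_EFin n (F : 'cV[R]_n -> R) : meas_Rn F -> emeas (fun v => (F v)%:E).
Proof. by move=> mF; apply/measurable_EFinP. Qed.

Lemma meas_RnD n (F G : 'cV[R]_n -> R) :
  meas_Rn F -> meas_Rn G -> meas_Rn (fun v => F v + G v).
Proof. exact: measurable_funD. Qed.

Lemma meas_RnM n (F G : 'cV[R]_n -> R) :
  meas_Rn F -> meas_Rn G -> meas_Rn (fun v => F v * G v).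
Proof. exact: measurable_funM. Qed.

Lemma meas_RnN n (F : 'cV[R]_n -> R) : meas_Rn F -> meas_Rn (fun v => - F v).
Proof. exact: measurable_funN. Qed.

Lemma meas_Rn_cst n (c : R) : meas_Rn (fun _ : 'cV[R]_n => c).
Proof. exact: measurable_cst. Qed.

Lemma meas_Rn_comp n (f : R -> R) (F : 'cV[R]_n -> R) :
  continuous f -> meas_Rn F -> meas_Rn (f \o F).
Proof.
by move=> cf mF; apply: (measurableT_comp (continuous_measurable_fun cf) mF).
Qed.

Lemma meas_Rn_coord n (i : 'I_n) : meas_Rn (fun v : 'cV[R]_n => v i 0).
Proof.
rewrite /meas_Rn (_ : _ \o _ = fun t : n.-tuple R => tnth t i).
  exact: measurable_tnth.
by apply/funext => t /=; rewrite !mxE.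
Qed.

Lemma meas_Rn_dotv n (w : 'cV[R]_n) : meas_Rn (dotv w).
Proof.
apply: (@measurable_sum _ (n.-tuple R) R setT 'I_n (index_enum 'I_n)
  (fun i t => w i 0 * (vec_of_tuple t) i 0)) => i.
by apply: measurable_funM => //; exact: meas_Rn_coord.
Qed.

Lemma emeas_reflection n (a : 'cV[R]_n) (F : 'cV[R]_n -> \bar R) :
  emeas F -> emeas (fun v => F (a - v)).
Proof.
move=> mF; rewrite /emeas.
rewrite [X in measurable_fun _ X](_ : _ = (F \o @vec_of_tuple R n) \o
   (fun t : n.-tuple R => [tuple a i 0 - tnth t i | i < n])).
  apply: measurableT_comp => //; apply/measurable_fun_tnthP => i /=.
  rewrite [X in measurable_fun _ X](_ : _ = fun t : n.-tuple R => a i 0 - tnth t i).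
    by apply: measurable_funB => //; exact: measurable_tnth.
  by apply/funext => t /=; rewrite tnth_mktuple.
apply/funext => t /=; congr F; apply/matrixP => i j.
by rewrite !mxE ord1 tnth_mktuple.
Qed.

Lemma meas_Rn_reflection n (a : 'cV[R]_n) (F : 'cV[R]_n -> R) :
  meas_Rn F -> meas_Rn (fun v => F (a - v)).
Proof.
move=> mF; apply/measurable_EFinP.
exact: (emeas_reflection a (emeas_EFin mF)).
Qed.

Lemma cmeasurableD n (f g : 'cV[R]_n -> R[i]) :
  cmeasurable f -> cmeasurable g -> cmeasurable (fun t => f t + g t).
Proof.
move=> [rf jf] [rg jg]; split.
  rewrite (_ : (fun _ => _) = fun t => Re (f t) + Re (g t)); first exact: meas_RnD.
  by apply/funext => t; case: (f t) (g t) => [? ?] [].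
rewrite (_ : (fun _ => _) = fun t => Im (f t) + Im (g t)); first exact: meas_RnD.
by apply/funext => t; case: (f t) (g t) => [? ?] [].
Qed.

Lemma cmeasurableM n (f g : 'cV[R]_n -> R[i]) :
  cmeasurable f -> cmeasurable g -> cmeasurable (fun t => f t * g t).
Proof.
move=> [rf jf] [rg jg]; split.
  rewrite (_ : (fun _ => _) = fun t => Re (f t) * Re (g t) + - (Im (f t) * Im (g t))).
    by apply: meas_RnD; [|apply: meas_RnN]; exact: meas_RnM.
  by apply/funext => t; case: (f t) (g t) => [? ?] [].
rewrite (_ : (fun _ => _) = fun t => Re (f t) * Im (g t) + Im (f t) * Re (g t)).
  by apply: meas_RnD; exact: meas_RnM.
by apply/funext => t; case: (f t) (g t) => [? ?] [].
Qed.

Lemma cmeasurable_conj n (f : 'cV[R]_n -> R[i]) :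
  cmeasurable f -> cmeasurable (fun t => conjc (f t)).
Proof.
move=> [rf jf]; split.
  rewrite (_ : (fun _ => _) = fun t => Re (f t)) //.
  by apply/funext => t; case: (f t).
rewrite (_ : (fun _ => _) = fun t => - Im (f t)); first exact: meas_RnN.
by apply/funext => t; case: (f t).
Qed.

Lemma cmeasurable_cst n (c : R[i]) : cmeasurable (fun _ : 'cV[R]_n => c).
Proof. by split; exact: meas_Rn_cst. Qed.

Lemma cmeasurable_expi n (F : 'cV[R]_n -> R) :
  meas_Rn F -> cmeasurable (fun t => expi (F t)).
Proof.
move=> mF; split.
  by apply: (meas_Rn_comp (f := @cos R)) => //; exact: continuous_cos.
by apply: (meas_Rn_comp (f := @sin R)) => //; exact: continuous_sin.
Qed.

Lemma cmeasurable_reflection n (a : 'cV[R]_n) (f : 'cV[R]_n -> R[i]) :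
  cmeasurable f -> cmeasurable (fun t => f (a - t)).
Proof.
move=> [rf jf]; split.
  exact: (meas_Rn_reflection a rf).
exact: (meas_Rn_reflection a jf).
Qed.

Lemma meas_Rn_sqnorm n (f : 'cV[R]_n -> R[i]) :
  cmeasurable f -> meas_Rn (fun t => sqnorm (f t)).
Proof.
by move=> [rf jf]; apply: meas_RnD; apply: (@measurable_funX _ _ R setT _ 2).
Qed.

(** * Algebra of the squared modulus *)

Lemma sqnorm_ge0 (z : R[i]) : 0 <= sqnorm z.
Proof. by rewrite addr_ge0 ?sqr_ge0. Qed.

Lemma sqnormM (z w : R[i]) : sqnorm (z * w) = sqnorm z * sqnorm w.
Proof. by case: z w => [a b] [c d]; rewrite /sqnorm /=; ring. Qed.

Lemma sqnorm_conj (z : R[i]) : sqnorm (conjc z) = sqnorm z.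
Proof. by case: z => [a b]; rewrite /sqnorm /=; ring. Qed.

Lemma sqnorm_expi (x : R) : sqnorm (expi x) = 1.
Proof. exact: cos2Dsin2. Qed.

(** By the parallelogram law the two sides differ by the squared modulus of [z - w]. *)
Lemma sqnormD_le (z w : R[i]) : sqnorm (z + w) <= 2 * sqnorm z + 2 * sqnorm w.
Proof.
case: z w => [a b] [c d]; rewrite /sqnorm /= -subr_ge0.
rewrite [leRHS](_ : _ = (a - c) ^+ 2 + (b - d) ^+ 2); last by ring.
by rewrite addr_ge0 ?sqr_ge0.
Qed.

Lemma sqnorm_eq0 (z : R[i]) : (sqnorm z == 0) = (z == 0).
Proof.
by case: z => a b; rewrite /sqnorm /= paddr_eq0 ?sqr_ge0// !sqrf_eq0 eq_complex.
Qed.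

(** * Real-valued integrals *)

Definition rintegrable n (F : 'cV[R]_n -> R) : Prop :=
  eintegrable (fun v => (F v)%:E).

(** [fine] sends an infinite integral to 0, so this number is the true integral only when [F] is
    integrable. *)
Definition rint n (F : 'cV[R]_n -> R) : R := fine (iint (fun v => (F v)%:E)).

Lemma rintE n (F : 'cV[R]_n -> R) : rintegrable F ->
  iint (fun v => (F v)%:E) = (rint F)%:E.
Proof. by move=> iF; rewrite /rint fineK// eintegrable_fin_num. Qed.

Lemma rintegrable_le n (F G : 'cV[R]_n -> R) : meas_Rn F -> rintegrable G ->
  (forall v, `|F v| <= G v) -> rintegrable F.
Proof.
move=> mF [mG Goo] FG; have mF' := emeas_EFin mF.
split => //; apply: le_lt_trans Goo.
apply: ge0_le_iint => //; [exact: emeas_abs..|].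
by move=> v; rewrite lee_fin (le_trans (FG v))// ler_norm.
Qed.

Lemma ge0_rintegrable n (F : 'cV[R]_n -> R) : meas_Rn F -> (forall v, 0 <= F v) ->
  (iint (fun v => (F v)%:E) < +oo)%E -> rintegrable F.
Proof.
move=> mF F0 Foo; split; first exact: emeas_EFin.
rewrite (_ : (fun _ => _) = fun v => (F v)%:E)//.
by apply/funext => v; rewrite /= ger0_norm.
Qed.

Lemma rintegrable_lin n (F G : 'cV[R]_n -> R) (a b : R) :
  rintegrable F -> rintegrable G -> rintegrable (fun v => a * F v + b * G v).
Proof.
move=> [mF Foo] [mG Goo].
have mF' := emeas_abs mF; have mG' := emeas_abs mG.
split; first exact: (emeas_lin a b mF mG).
have iF' : eintegrable (fun v => `|(F v)%:E|)%E.
  by split => //; under eq_fun do rewrite abse_id.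
have iG' : eintegrable (fun v => `|(G v)%:E|)%E.
  by split => //; under eq_fun do rewrite abse_id.
apply: (@le_lt_trans _ _
  (iint (fun v => `|a|%:E * `|(F v)%:E| + `|b|%:E * `|(G v)%:E|)%E)).
  apply: ge0_le_iint => //.
  - exact: (emeas_abs (emeas_lin a b mF mG)).
  - exact: emeas_lin.
  - by move=> v; rewrite -!EFinM -EFinD lee_fin -!normrM ler_normD.
by rewrite iint_lin// ltey_eq fin_numD !fin_numM ?eintegrable_fin_num.
Qed.

Lemma rint_lin n (F G : 'cV[R]_n -> R) (a b : R) :
  rintegrable F -> rintegrable G ->
  rint (fun v => a * F v + b * G v) = a * rint F + b * rint G.
Proof.
move=> iF iG; have := iint_lin a b iF iG; rewrite (rintE iF) (rintE iG) => E.
by rewrite /rint (_ : iint _ = (a * rint F + b * rint G)%:E).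
Qed.

Lemma rint_reflection n (a : 'cV[R]_n) (F : 'cV[R]_n -> R) :
  meas_Rn F -> rint (fun v => F (a - v)) = rint F.
Proof. by move=> /emeas_EFin mF; rewrite /rint (iint_reflection a mF). Qed.

Lemma rintegrable_reflection n (a : 'cV[R]_n) (F : 'cV[R]_n -> R) :
  rintegrable F -> rintegrable (fun v => F (a - v)).
Proof.
move=> [mF Foo]; split; first exact: emeas_reflection mF.
by rewrite (iint_reflection a (emeas_abs mF)).
Qed.

(** * Complex-valued integrals *)

Definition cintegrable n (h : 'cV[R]_n -> R[i]) : Prop :=
  rintegrable (fun t => Re (h t)) /\ rintegrable (fun t => Im (h t)).

Lemma cintE n (h : 'cV[R]_n -> R[i]) :
  cint h = (rint (fun t => Re (h t)) +i* rint (fun t => Im (h t)))%C.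
Proof. by []. Qed.

Lemma cintD n (h k : 'cV[R]_n -> R[i]) : cintegrable h -> cintegrable k ->
  cint (fun t => h t + k t) = cint h + cint k.
Proof.
move=> [rh jh] [rk jk]; rewrite !cintE.
have -> : (fun t => Re (h t + k t)) = (fun t => 1 * Re (h t) + 1 * Re (k t)).
  by apply/funext => t; case: (h t) (k t) => ? ? [? ?] /=; rewrite !mul1r.
have -> : (fun t => Im (h t + k t)) = (fun t => 1 * Im (h t) + 1 * Im (k t)).
  by apply/funext => t; case: (h t) (k t) => ? ? [? ?] /=; rewrite !mul1r.
by rewrite !rint_lin// !mul1r.
Qed.

Lemma cintZ n (c : R[i]) (h : 'cV[R]_n -> R[i]) : cintegrable h ->
  cint (fun t => c * h t) = c * cint h.
Proof.
case: c => a b [rh jh]; rewrite !cintE.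
have -> : (fun t => Re ((a +i* b)%C * h t)) = (fun t => a * Re (h t) + (- b) * Im (h t)).
  by apply/funext => t; case: (h t) => ? ? /=; rewrite mulNr.
have -> : (fun t => Im ((a +i* b)%C * h t)) = (fun t => a * Im (h t) + b * Re (h t)).
  by apply/funext => t; case: (h t) => ? ? /=.
by rewrite !rint_lin// mulNr.
Qed.

Lemma cint_conj n (h : 'cV[R]_n -> R[i]) : cintegrable h ->
  cint (fun t => conjc (h t)) = conjc (cint h).
Proof.
move=> [rh jh]; rewrite !cintE.
have -> : (fun t => Re (conjc (h t))) = (fun t => Re (h t)).
  by apply/funext => t; case: (h t).
(* The zero summand brings the negated integrand into the two-term form of [rint_lin]. *)
have -> : (fun t => Im (conjc (h t))) = (fun t => (- 1) * Im (h t) + 0 * Im (h t)).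
  by apply/funext => t; case: (h t) => ? ? /=; rewrite mul0r addr0 mulN1r.
by rewrite !rint_lin//= mul0r addr0 mulN1r.
Qed.

Lemma cint_reflection n (a : 'cV[R]_n) (h : 'cV[R]_n -> R[i]) :
  cmeasurable h -> cint (fun t => h (a - t)) = cint h.
Proof.
move=> [rh jh]; rewrite !cintE.
by rewrite (rint_reflection a rh) (rint_reflection a jh).
Qed.

(** * Stability of square-integrability *)

Lemma L2_rintegrable n (f : 'cV[R]_n -> R[i]) : L2 f <->
  cmeasurable f /\ rintegrable (fun t => sqnorm (f t)).
Proof.
split=> -[mf foo]; split => //.
  by apply: ge0_rintegrable => // [|v]; [exact: meas_Rn_sqnorm|exact: sqnorm_ge0].
by rewrite rintE// ltry.
Qed.

Lemma L2_reflection n (a : 'cV[R]_n) (f : 'cV[R]_n -> R[i]) :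
  L2 f -> L2 (fun t => f (a - t)).
Proof.
move=> /L2_rintegrable[mf fi]; apply/L2_rintegrable; split.
  exact: cmeasurable_reflection.
exact: (rintegrable_reflection a fi).
Qed.

(** A translation is the composite of two reflections. *)
Lemma L2_translation n (a : 'cV[R]_n) (f : 'cV[R]_n -> R[i]) :
  L2 f -> L2 (fun t => f (t - a)).
Proof.
move=> /(L2_reflection 0)/(L2_reflection a).
rewrite (_ : (fun t => f (0 - (a - t))) = fun t => f (t - a))//.
by apply/funext => t; rewrite sub0r opprB.
Qed.

Lemma L2D n (f g : 'cV[R]_n -> R[i]) : L2 f -> L2 g -> L2 (fun t => f t + g t).
Proof.
move=> /L2_rintegrable[mf fi] /L2_rintegrable[mg gi]; apply/L2_rintegrable.
have mfg := cmeasurableD mf mg; split => //.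
apply: (rintegrable_le (meas_Rn_sqnorm mfg) (rintegrable_lin 2 2 fi gi)) => v.
by rewrite ger0_norm ?sqnorm_ge0// sqnormD_le.
Qed.

(** A multiplier of constant modulus covers both phase factors and scalar constants. *)
Lemma L2M n (f u : 'cV[R]_n -> R[i]) (c : R) : L2 f -> cmeasurable u ->
  (forall t, sqnorm (u t) = c) -> L2 (fun t => u t * f t).
Proof.
move=> /L2_rintegrable[mf fi] mu uc; apply/L2_rintegrable.
split; first exact: cmeasurableM.
have -> : (fun t => sqnorm (u t * f t)) = fun t => c * sqnorm (f t) + 0 * sqnorm (f t).
  by apply/funext => t; rewrite sqnormM uc mul0r addr0.
exact: rintegrable_lin.
Qed.

Lemma cintegrable_dom n (h : 'cV[R]_n -> R[i]) (F : 'cV[R]_n -> R) :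
  cmeasurable h -> rintegrable F -> (forall t, 0 <= F t) ->
  (forall t, sqnorm (h t) <= F t ^+ 2) -> cintegrable h.
Proof.
move=> [rh jh] iF F0 hF.
by split; apply: (rintegrable_le _ iF) => // t;
  rewrite -(ler_pXn2r (ltn0Sn 1)) ?nnegrE// real_normK ?num_real//;
  apply: le_trans (hF t); rewrite /sqnorm ?lerDl ?lerDr sqr_ge0.
Qed.

(** The integrand has modulus |f(t)| |g(t - x)|, which is at most |f(t)|^2 + |g(t - x)|^2. The bound
    is checked after squaring, where it reads pq <= (p + q)^2 for the squared moduli p and q. *)
Lemma cintegrable_stft n (f g : 'cV[R]_n -> R[i]) (x w : 'cV[R]_n) :
  L2 f -> L2 g ->
  cintegrable (fun t => f t * conjc (g (t - x)) * expi (- (2 * pi) * dotv w t)).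
Proof.
move=> /L2_rintegrable[mf fi] /(L2_translation x)/L2_rintegrable[mg gi].
apply: (cintegrable_dom _ (rintegrable_lin 1 1 fi gi)).
- apply: cmeasurableM; first by apply: cmeasurableM => //; exact: cmeasurable_conj.
  apply: cmeasurable_expi; apply: meas_RnM; first exact: meas_Rn_cst.
  exact: meas_Rn_dotv.
- by move=> t; rewrite !mul1r addr_ge0// sqnorm_ge0.
- move=> t; rewrite !sqnormM sqnorm_conj sqnorm_expi mulr1 !mul1r.
  have := sqnorm_ge0 (f t); have := sqnorm_ge0 (g (t - x)).
  move: (sqnorm _) (sqnorm _) => p q q0 p0.
  rewrite -subr_ge0 (_ : _ - _ = p ^+ 2 + q ^+ 2 + p * q); last by ring.
  by rewrite !addr_ge0 ?sqr_ge0 ?mulr_ge0.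
Qed.

End ComplexIntegral.

(** * The phase of the transform of a reflected window *)

Section Phase.
Set Implicit Arguments.
Unset Strict Implicit.
Context {R : realType}.
Local Notation Re := complex.Re.
Local Notation Im := complex.Im.
Local Notation iC := (0 +i* 1)%C.

Lemma expiD (x y : R) : expi (x + y) = expi x * expi y.
Proof.
rewrite /expi cosD sinD; apply/eqP; rewrite eq_complex /= eqxx /=.
by rewrite addrC eqxx.
Qed.

Lemma expi0 : expi (0 : R) = 1.
Proof. by rewrite /expi cos0 sin0. Qed.

Lemma conjc_expi (x : R) : conjc (expi x) = expi (- x).
Proof. by rewrite /expi cosN sinN. Qed.

Lemma conjcM (a b : R[i]) : conjc (a * b) = conjc a * conjc b.
Proof. exact: rmorphM. Qed.

Lemma conjcD (a b : R[i]) : conjc (a + b) = conjc a + conjc b.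
Proof. exact: rmorphD. Qed.

Lemma expi_int (k : int) : expi (2 * pi * k%:~R : R) = 1.
Proof.
have nat_case (n : nat) : expi (2 * pi * n%:R : R) = 1.
  have -> : 2 * pi * n%:R = 0 + (pi *+ 2) *+ n :> R.
    by rewrite add0r -[in RHS]mulrnA -[RHS]mulr_natr natrM; ring.
  rewrite /expi (periodicn (@cosD2pi R)) (periodicn (@sinD2pi R)).
  by rewrite cos0 sin0.
case: k => n; first exact: nat_case.
by rewrite NegzE mulrNz mulrN -conjc_expi nat_case conjc1.
Qed.

(** Subtracting a multiple of 2 pi brings [x] to some [r] in [0, 2 pi[. Injectivity of cosine on
    [0, pi] gives [r = 0] directly when [r <= pi]; otherwise, applied to 2 pi - r, it would force r
    = 2 pi. *)
Lemma cos_eq1 (x : R) : cos x = 1 -> exists k : int, x = 2 * pi * k%:~R.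
Proof.
have pi2 : 0 < 2 * pi :> R by rewrite mulr_gt0// pi_gt0.
pose k := Num.floor (x / (2 * pi)); pose r := x - 2 * pi * k%:~R.
have r0 : 0 <= r.
  by rewrite subr_ge0 mulrC -ler_pdivlMr// floor_le.
have r1 : r < 2 * pi.
  rewrite ltrBlDr -[X in X + _]mulr1 -mulrDr mulrC -ltr_pdivrMr// addrC.
  by have := floorD1_gt (x / (2 * pi)); rewrite intrD.
have xr : x = r + 2 * pi * k%:~R by rewrite subrK.
have -> : cos x = cos r.
  have : expi x = expi r by rewrite xr expiD expi_int mulr1.
  by case.
move=> cr; exists k; suff r00 : r = 0 by rewrite xr r00 add0r.
have pi0 := @pi_gt0 R.
have [rpi|rpi] := leP r pi.
  by apply: (@cos_inj R); rewrite ?in_itv/= ?lexx ?r0 ?rpi ?(ltW pi0)// cos0.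
have : 2 * pi - r = 0.
  apply: (@cos_inj R); rewrite ?in_itv/= ?lexx ?(ltW pi0)//; last first.
    rewrite cos0 -[RHS]cr -[RHS]cosN -(cosD2pi (- r)); congr (cos _).
    by rewrite addrC mulr_natl.
  by apply/andP; split; lra.
lra.
Qed.

Lemma expi_inj (x y : R) : expi x = expi y ->
  exists k : int, x = y + 2 * pi * k%:~R.
Proof.
move=> E; have [|k Ek] := @cos_eq1 (x - y).
  have : expi (x - y) = 1.
    rewrite expiD E -conjc_expi -sqr_normc normc_def /= cos2Dsin2.
    by rewrite sqrtr1 expr1n.
  by case.
by exists k; rewrite -Ek addrC subrK.
Qed.

(** As [b] is nonzero, the equation fixes the value of the exponential, so any two solutions differ
    by an integer. *)
Lemma countable_expi_eq (a b : R[i]) : b != 0 ->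
  countable [set s : R | a + b * expi (2 * pi * s) = 0].
Proof.
move=> b0; set C := [set s | _].
have [[s0 Cs0]|nC] := pselect (exists s, C s); last first.
  rewrite (_ : C = set0)//.
  by apply/seteqP; split => // s Cs; exfalso; apply: nC; exists s.
have sub : C `<=` [set s0 + k%:~R | k in [set: int]].
  move=> s Cs.
  have E : expi (2 * pi * s) = expi (2 * pi * s0).
    by apply: (mulfI b0); apply: (addrI a); rewrite [LHS]Cs [RHS]Cs0.
  have [k Ek] := expi_inj E; exists k => //.
  apply: (mulfI (_ : 2 * pi != 0 :> R)); last by rewrite mulrDr -Ek.
  by rewrite mulf_neq0 ?pnatr_eq0// gt_eqF// pi_gt0.
apply: (sub_countable (subset_card_le sub)).
exact: (sub_countable (card_image_le _ _) (countableP _)).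
Qed.

Lemma dotvDr n (w a b : 'cV[R]_n) : dotv w (a + b) = dotv w a + dotv w b.
Proof. by rewrite /dotv -big_split; apply: eq_bigr => i _; rewrite !mxE mulrDr. Qed.

Lemma dotvNr n (w a : 'cV[R]_n) : dotv w (- a) = - dotv w a.
Proof. by rewrite /dotv -sumrN; apply: eq_bigr => i _; rewrite !mxE mulrN. Qed.

Lemma dotvC n (a b : 'cV[R]_n) : dotv a b = dotv b a.
Proof. by apply: eq_bigr => i _; rewrite mulrC. Qed.

Lemma dotv0l n (a : 'cV[R]_n) : dotv 0 a = 0.
Proof. by rewrite /dotv big1// => i _; rewrite mxE mul0r. Qed.

Lemma dotv_col_mx m n (a b : 'cV[R]_m) (a' b' : 'cV[R]_n) :
  dotv (col_mx a a') (col_mx b b') = dotv a b + dotv a' b'.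
Proof.
by rewrite /dotv big_split_ord; congr (_ + _); apply: eq_bigr => i _;
  rewrite ?col_mxEu ?col_mxEd.
Qed.

(** The exponent is odd about the centre u/2, so [t -> u - t] conjugates the phase factor. At
    [u = eta = 0] this is the plain reflected window. *)
Definition tfrefl n (g : 'cV[R]_n -> R[i]) (u eta t : 'cV[R]_n) : R[i] :=
  expi (pi * (2 * dotv eta t - dotv eta u)) * g (u - t).

Lemma cmeasurable_tfrefl_phase n (u eta : 'cV[R]_n) :
  cmeasurable (fun t => expi (pi * (2 * dotv eta t - dotv eta u))).
Proof.
apply: cmeasurable_expi; apply: meas_RnM; first exact: meas_Rn_cst.
apply: meas_RnD; last exact: meas_Rn_cst.
by apply: meas_RnM; [exact: meas_Rn_cst|exact: meas_Rn_dotv].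
Qed.

Lemma L2_tfrefl n (g : 'cV[R]_n -> R[i]) (u eta : 'cV[R]_n) :
  L2 g -> L2 (tfrefl g u eta).
Proof.
move=> /(L2_reflection u) Lg.
by apply: (L2M Lg (cmeasurable_tfrefl_phase u eta)) => t; exact: sqnorm_expi.
Qed.

Lemma sqnorm_tfrefl n (g : 'cV[R]_n -> R[i]) (u eta t : 'cV[R]_n) :
  sqnorm (tfrefl g u eta t) = sqnorm (g (u - t)).
Proof. by rewrite sqnormM sqnorm_expi mul1r. Qed.

(** The substitution [t -> u + x - t] exchanges the two occurrences of [g], which undoes the
    conjugation on them. Only phases remain to be compared. *)
Lemma conjc_stft_tfrefl n (g : 'cV[R]_n -> R[i]) (u eta x w : 'cV[R]_n) (k : int) :
  L2 g -> dotv eta x - dotv w u = k%:~R ->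
  conjc (stft g (tfrefl g u eta) x w) =
    expi (2 * pi * dotv w x) * stft g (tfrefl g u eta) x w.
Proof.
move=> Lg Ek; have Lr := L2_tfrefl u eta Lg.
have ih := cintegrable_stft x w Lr Lg.
set h := (fun t => _) in ih; rewrite /stft -/h.
have mh : cmeasurable h.
  by case: ih => [[+ _] [+ _]]; split; apply/measurable_EFinP.
rewrite -cintZ// -cint_conj// -(cint_reflection (u + x) (cmeasurable_conj mh)).
congr cint; apply/funext => t.
rewrite /h /tfrefl !conjcM conjcK !conjc_expi.
have -> : u - (u + x - t) = t - x by rewrite !opprD opprK !addrA subrr add0r addrC.
have -> : u + x - t - x = u - t by rewrite addrAC addrK.
suff : expi (- (pi * (2 * dotv eta (u + x - t) - dotv eta u))) *
       expi (- (- (2 * pi) * dotv w (u + x - t))) =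
       expi (2 * pi * dotv w x) * expi (pi * (2 * dotv eta t - dotv eta u)) *
       expi (- (2 * pi) * dotv w t) by move=> E; ring: E.
(* The exponents on the two sides differ by exactly -2 pi k, so a factor equal to 1 is inserted on
   the right to absorb the difference. *)
rewrite -!expiD -[RHS]mulr1 -(expi_int (- k)) -expiD; congr expi.
rewrite mulrNz -Ek !dotvDr !dotvNr; ring.
Qed.

Lemma stft_lin n (g f1 f2 : 'cV[R]_n -> R[i]) (c : R[i]) (x w : 'cV[R]_n) :
  L2 g -> L2 f1 -> L2 f2 ->
  stft g (fun t => f1 t + c * f2 t) x w = stft g f1 x w + c * stft g f2 x w.
Proof.
move=> Lg L1 L2'.
have i1 := cintegrable_stft x w L1 Lg; have i2 := cintegrable_stft x w L2' Lg.
have Lc : L2 (fun t => c * f2 t).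
  exact: (L2M L2' (cmeasurable_cst _ c) (fun=> erefl)).
have ic := cintegrable_stft x w Lc Lg.
rewrite /stft -(cintZ c i2) -cintD//; last first.
  rewrite [X in cintegrable X](_ : _ =
    fun t => c * f2 t * conjc (g (t - x)) * expi (- (2 * pi) * dotv w t))//.
  by apply/funext => t; rewrite !mulrA.
by congr cint; apply/funext => t; ring.
Qed.

(** Multiplying each sum by its conjugate gives c (a^2 + b^2) in both cases, since the sign of [b]
    disappears. *)
Lemma normc_eq_of_conj (a b c : R[i]) : conjc a = c * a -> conjc b = c * b ->
  `|a + iC * b| = `|a + - iC * b|.
Proof.
move=> ha hb; apply/eqP; rewrite -(eqrXn2 (ltn0Sn 1))// !sqr_normc.
rewrite !conjcD !conjcM ha hb.
have -> : conjc iC = - iC :> R[i] by apply/eqP; rewrite eq_complex /= oppr0 !eqxx.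
have -> : conjc (- iC) = iC :> R[i] by apply/eqP; rewrite eq_complex /= oppr0 opprK !eqxx.
by apply/eqP; ring.
Qed.

End Phase.

(** * Linear independence *)

Section Independence.
Set Implicit Arguments.
Unset Strict Implicit.
Context {R : realType}.
Local Notation mu := (@lebesgue_measure R).
Local Notation iC := (0 +i* 1)%C.

Lemma countable_affine_preimage (a b : R) (C : set R) : a != 0 -> countable C ->
  countable [set t | C (a * t + b)].
Proof.
move=> a0 cC.
have sub : [set t | C (a * t + b)] `<=` [set (s - b) / a | s in C].
  by move=> t Ct; exists (a * t + b) => //; rewrite addrK mulrAC mulfV// mul1r.
apply: (sub_countable (subset_card_le sub)).
exact: (sub_countable (card_image_le _ _) cC).
Qed.

(** Induction by slices. If [eta] has a nonzero tail, every slice is again a countable union of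
    hyperplanes, with the offset [b] absorbing the first coordinate. Otherwise only countably many
    values of the first coordinate give a nonzero slice. *)
Lemma iint_countable_hyperplanes n (eta : 'cV[R]_n) (b : R) (C : set R)
    (F : 'cV[R]_n -> \bar R) :
  eta != 0 -> countable C -> emeas F ->
  (forall v, ~ C (dotv eta v + b) -> F v = 0%E) -> iint F = 0%E.
Proof.
elim: n eta b F => [|n IH] eta b F eta0 cC mF FC /=.
  by move: eta0; rewrite (_ : eta = 0) ?eqxx//; apply/matrixP => -[].
pose e : 'cV[R]_(1 + n) := eta.
have dE (t : R) (v : 'cV[R]_n) :
    dotv eta (col_mx t%:M v : 'cV[R]_n.+1) = e 0 0 * t + dotv (dsubmx e) v.
  have := dotv_col_mx (usubmx e) t%:M (dsubmx e) v.
  rewrite vsubmxK /e => ->; congr (_ + _).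
  rewrite /dotv big_ord1 !mxE eqxx mulr1n; congr (e _ _ * _).
  by apply/val_inj.
have [de0|de0] := eqVneq (dsubmx e) 0; last first.
  under eq_integral => t _.
    rewrite (IH (dsubmx e) (e 0 0 * t + b) _ de0 cC (emeas_section _ mF)); last first.
      by move=> v nC; apply: FC; rewrite dE -addrA addrCA.
    over.
  exact: integral0.
have e00 : e 0 0 != 0.
  apply: contra eta0 => /eqP e0; apply/eqP; rewrite -[eta]/e -[e]vsubmxK de0.
  rewrite (_ : usubmx e = 0) ?col_mx0//; apply/matrixP => i j.
  rewrite !ord1 !mxE -[RHS]e0; congr (e _ _); exact/val_inj.
rewrite (ae_eq_integral (cst 0%E)) ?integral0//; first exact: measurable_iint_col_mx.
have cN := countable_affine_preimage b e00 cC.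
have : mu.-negligible [set t | C (e 0 0 * t + b)].
  apply/negligibleP; last exact: countable_lebesgue_measure0.
  by apply: countable_measurable => // t; exact: measurable_set1.
apply: negligibleS => t /= nt; apply: contrapT => nC; apply: nt => _.
rewrite [RHS](_ : _ = iint (fun _ : 'cV[R]_n => 0%E)); last by rewrite iint_cst0.
congr iint; apply/funext => v; apply: FC; rewrite dE de0 dotv0l addr0.
exact: nC.
Qed.

(** The indicator of the unit cube works: as a product over coordinates its iterated integral
    factors. It provides a function distinct from 0 for the case of a null window. *)
Lemma exists_L2_norm1 n : exists2 f : 'cV[R]_n -> R[i],
  L2 f & iint (fun t => (sqnorm (f t))%:E) = 1%E.
Proof.
pose h : R -> R := \1_`[0, 1]%classic.
pose F n := fun v : 'cV[R]_n => \prod_i h (v i 0).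
have h0 t : 0 <= h t by rewrite /h indicE ler0n.
have mh : measurable_fun [set: R] h by apply: measurable_indic.
have mF m : meas_Rn (F m).
  apply: (@measurable_prod _ (m.-tuple R) R setT 'I_m (index_enum 'I_m)
    (fun i t => h ((vec_of_tuple t) i 0))) => i _.
  exact: (measurableT_comp mh (meas_Rn_coord i)).
have F0 m v : 0 <= F m v by rewrite /F prodr_ge0.
have iF m : iint (fun v => (F m v)%:E) = 1%E.
  elim: m => [|m IH] /=; first by rewrite /F big_ord0.
  have iFm : eintegrable (fun v => (F m v)%:E).
    split; first exact: (emeas_EFin (mF m)).
    rewrite (_ : (fun _ => _) = fun v => (F m v)%:E) ?IH ?ltry//.
    by apply/funext => v; rewrite gee0_abs// lee_fin.
  under eq_integral => t _.
    rewrite (_ : iint _ = (h t)%:E); last first.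
      rewrite (_ : (fun _ => _) = fun v => ((h t)%:E * (F m v)%:E + 0%:E * (F m v)%:E)%E).
        by rewrite iint_lin// IH mul0e adde0 mule1.
      apply/funext => v; rewrite mul0e adde0 -EFinM; congr (_%:E).
      rewrite /F big_ord_recl; congr (_ * _).
        rewrite (_ : ord0 = lshift m (ord0 : 'I_1)); last exact/val_inj.
        by rewrite (col_mxEu (t%:M : 'M_1) v) mxE eqxx mulr1n.
      apply: eq_bigr => i _; rewrite (_ : lift ord0 i = rshift 1 i); last exact/val_inj.
      by rewrite (col_mxEd (t%:M : 'M_1) v).
    over.
  rewrite /h integral_indic// setIT.
  have := lebesgue_measure_itv (`[0%R, 1%R] : interval R).
  by rewrite /= lte_fin ltr01 oppr0 adde0.
(* An indicator equals its own square. *)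
have sE t : sqnorm ((F n t)%:C)%C = F n t.
  rewrite /sqnorm /= expr0n addr0 /F -prodrXl; apply: eq_bigr => i _.
  by rewrite /h indicE; case: (_ \in _); rewrite ?expr1n ?expr0n.
exists (fun t => ((F n t)%:C)%C).
  split; first by split => //; exact: meas_Rn_cst.
  by under eq_fun do rewrite sE; rewrite iF ltry.
by under eq_fun do rewrite sE.
Qed.

Lemma emeas_translation n (a : 'cV[R]_n) (F : 'cV[R]_n -> \bar R) :
  emeas F -> emeas (fun v => F (v - a)).
Proof.
move=> /(emeas_reflection 0)/(emeas_reflection a).
rewrite (_ : (fun v => F (0 - (a - v))) = fun v => F (v - a))//.
by apply/funext => v; rewrite sub0r opprB.
Qed.

Lemma iint_translation n (a : 'cV[R]_n) (F : 'cV[R]_n -> \bar R) :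
  emeas F -> iint (fun v => F (v - a)) = iint F.
Proof.
move=> mF; rewrite -[RHS](iint_reflection 0 mF).
rewrite -[RHS](iint_reflection a (emeas_reflection 0 mF)).
by congr iint; apply/funext => v; rewrite sub0r opprB.
Qed.

(** The integrand vanishes wherever [g (t - x)] does, so the squared modulus of the translated
    window serves as the null function [D]. *)
Lemma stft_null_window n (g f : 'cV[R]_n -> R[i]) (x w : 'cV[R]_n) :
  L2 g -> L2 f -> iint (fun t => (sqnorm (g t))%:E) = 0%E -> stft g f x w = 0.
Proof.
move=> Lg Lf g0.
have mG := emeas_EFin (meas_Rn_sqnorm Lg.1).
have mD := emeas_translation x mG.
have D0 (v : 'cV[R]_n) : (0 <= (sqnorm (g (v - x)))%:E)%E by rewrite lee_fin sqnorm_ge0.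
have iD : iint (fun v => (sqnorm (g (v - x)))%:E) = 0%E.
  by rewrite (iint_translation x mG).
have [[mRe _] [mIm _]] := cintegrable_stft x w Lf Lg.
have hD v : (sqnorm (g (v - x)))%:E = 0%E ->
    f v * conjc (g (v - x)) * expi (- (2 * pi) * dotv w v) = 0.
  by move=> [] /eqP; rewrite sqnorm_eq0 => /eqP ->; rewrite conjc0 mulr0 mul0r.
have m0 := emeas_EFin (@meas_Rn_cst R n 0).
rewrite /stft /cint (eq_iint_off_null mD D0 iD mRe m0); last first.
  by move=> v /hD ->.
rewrite (eq_iint_off_null mD D0 iD mIm m0); last by move=> v /hD ->.
by rewrite iint_cst0.
Qed.

Lemma rint_translation n (a : 'cV[R]_n) (F : 'cV[R]_n -> R) :
  meas_Rn F -> rint (fun v => F (v - a)) = rint F.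
Proof. by move=> /emeas_EFin mF; rewrite /rint (iint_translation a mF). Qed.

Lemma eq_rint_off_null n (D F G : 'cV[R]_n -> R) :
  meas_Rn D -> (forall v, 0 <= D v) -> iint (fun v => (D v)%:E) = 0%E ->
  meas_Rn F -> meas_Rn G -> (forall v, D v = 0 -> F v = G v) -> rint F = rint G.
Proof.
move=> /emeas_EFin mD D0 iD /emeas_EFin mF /emeas_EFin mG FG; congr fine.
apply: (eq_iint_off_null mD) => // v.
by case=> /FG ->.
Qed.

(* Integrating F against atan (t_j / u_j), which the translation by u shifts by
   one, shows that F times a positive function has integral zero. *)
Lemma rint_translation_invariant_eq0 n (u : 'cV[R]_n) (D F : 'cV[R]_n -> R) :
  u != 0 -> meas_Rn D -> (forall v, 0 <= D v) -> iint (fun v => (D v)%:E) = 0%E ->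
  rintegrable F -> (forall v, 0 <= F v) ->
  (forall v, D v = 0 -> F (v - u) = F v) -> rint F = 0.
Proof.
move=> u0 mD D0 iD iF F0 FD.
have mF : meas_Rn F by case: iF => /measurable_EFinP.
have [j uj] : exists j, u j 0 != 0.
  apply/existsP; apply: contraR u0; rewrite negb_exists => /forallP u0.
  by apply/eqP/matrixP => i k; rewrite ord1 mxE; apply/eqP; rewrite -[_ == _]negbK u0.
pose s (v : 'cV[R]_n) : R := v j 0 / u j 0.
have su v : s (v - u) = s v - 1 by rewrite /s !mxE mulrBl divff.
have ms : meas_Rn s by apply: meas_RnM; [exact: meas_Rn_coord|exact: meas_Rn_cst].
have matan (c : R) : meas_Rn (fun v => atan (s v - c)).
  apply: (meas_Rn_comp (f := @atan R) (F := fun v => s v - c)).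
    exact: continuous_atan.
  by apply: meas_RnD => //; exact: meas_Rn_cst.
have mFa c : meas_Rn (fun v => F v * atan (s v - c)) by exact: meas_RnM.
(* The arctangent is bounded, so the product is dominated by [pi * F]. *)
have iFa c : rintegrable (fun v => F v * atan (s v - c)).
  apply: (rintegrable_le (mFa c) (rintegrable_lin pi 0 iF iF)) => v.
  rewrite mul0r addr0 normrM ger0_norm// mulrC ler_wpM2r// ler_norml.
  have := atan_gtNpi2 (s v - c); have := atan_ltpi2 (s v - c).
  by have := @pi_gt0 R => *; apply/andP; split; lra.
have shift : rint (fun v => F v * atan (s v - 1)) = rint (fun v => F v * atan (s v - 0)).
  rewrite -(rint_translation u (mFa 0)); apply: (eq_rint_off_null mD) => //.
    have : meas_Rn (fun v => F v * atan (s v - 0)) by exact: mFa.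
    by move=> /emeas_EFin/(emeas_translation u)/measurable_EFinP.
  by move=> v Dv /=; rewrite FD// su subr0.
pose E v := F v * (atan (s v) - atan (s v - 1)).
have EE : E = fun v => 1 * (F v * atan (s v - 0)) + (-1) * (F v * atan (s v - 1)).
  by apply/funext => v; rewrite /E subr0; ring.
have iE : rintegrable E by rewrite EE; exact: rintegrable_lin.
have mE : meas_Rn E by case: iE => /measurable_EFinP.
have dat v : 0 < atan (s v) - atan (s v - 1).
  by rewrite subr_gt0 lt_atan// ltrBlDr ltrDl.
have E0 : iint (fun v => (E v)%:E) = 0%E.
  by rewrite rintE// EE rint_lin// shift mul1r mulN1r subrr.
(* Now [E] itself is the null function: its second factor is positive, so [F] vanishes wherever [E]
   does. *)
rewrite (eq_rint_off_null (G := fun=> 0) mE _ E0)//.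
- by rewrite /rint iint_cst0.
- by move=> v; rewrite mulr_ge0// ltW.
- exact: meas_Rn_cst.
- by move=> v /eqP; rewrite mulf_eq0 (gt_eqF (dat v)) orbF => /eqP.
Qed.

Lemma tfrefl_independent n (g : 'cV[R]_n -> R[i]) (u eta : 'cV[R]_n) :
  L2 g -> iint (fun t => (sqnorm (g t))%:E) <> 0%E -> (u != 0) || (eta != 0) ->
  ~ exists nu : R[i], `|nu| = 1 /\
     L2_eq (fun t => tfrefl g 0 0 t + iC * tfrefl g u eta t)
           (fun t => nu * (tfrefl g 0 0 t + - iC * tfrefl g u eta t)).
Proof.
move=> Lg g0 p0 [nu [nu1]].
have L0 := L2_tfrefl 0 0 Lg; have L1 := L2_tfrefl u eta Lg.
(* [D] encodes the exceptional set: it has integral zero, and the pointwise identities below are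
   claimed only where it vanishes. *)
pose D t := sqnorm (tfrefl g 0 0 t + iC * tfrefl g u eta t -
  nu * (tfrefl g 0 0 t + - iC * tfrefl g u eta t)).
change (iint (fun t => (D t)%:E) = 0%E -> False).
(* Collecting terms turns the supposed equality into a linear relation between the two reflected
   windows with these coefficients. *)
pose a := 1 - nu; pose b := iC * (1 + nu).
have DE t : D t = sqnorm (a * tfrefl g 0 0 t + b * tfrefl g u eta t).
  by rewrite /D; congr sqnorm; rewrite /a /b; ring.
have mD : meas_Rn D.
  rewrite (funext DE); apply: meas_Rn_sqnorm; apply: cmeasurableD;
    by apply: cmeasurableM; [exact: cmeasurable_cst|case: L0 L1 => ? _ []].
have D0 v : 0 <= D v by exact: sqnorm_ge0.
move=> iD.
pose F v := sqnorm (g (0 - v)).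
have [mF iF] : meas_Rn F /\ rintegrable F.
  have [mf fi] := (L2_rintegrable _).1 (L2_reflection 0 Lg).
  by split => //; exact: meas_Rn_sqnorm.
have F0 v : 0 <= F v by exact: sqnorm_ge0.
have FD v : D v = 0 -> sqnorm a * F v = sqnorm b * F (v - u).
  rewrite DE => /eqP; rewrite sqnorm_eq0 addr_eq0 => /eqP /(congr1 (@sqnorm R)).
  rewrite -mulNr (sqnormM a) (sqnormM (- b)) !sqnorm_tfrefl /F.
  have -> : sqnorm (- b) = sqnorm b.
    by rewrite -mulN1r sqnormM /sqnorm /= oppr0 expr0n addr0 sqrrN expr1n mul1r.
  by move=> ->; rewrite !sub0r opprB.
have N0 : rint F != 0.
  apply/eqP => rF; apply: g0.
  rewrite -(iint_reflection 0 (emeas_EFin (meas_Rn_sqnorm Lg.1))).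
  by rewrite (rintE iF) rF.
have mFu : meas_Rn (fun v => F (v - u)).
  by move: mF => /emeas_EFin/(emeas_translation u)/measurable_EFinP.
have iFu : rintegrable (fun v => F (v - u)).
  have [mf fi] := (L2_rintegrable _).1 (L2_reflection u Lg).
  rewrite (_ : (fun _ => _) = fun v => sqnorm (g (u - v)))//.
  by apply/funext => v; rewrite /F sub0r opprB.
(* [F] and its translate have the same nonzero integral, so integrating [FD] compares the
   coefficients. *)
have ab : sqnorm a = sqnorm b.
  apply: (mulIf N0); rewrite -{2}(rint_translation u mF).
  have -> : sqnorm a * rint F = rint (fun v => sqnorm a * F v + 0 * F v).
    by rewrite rint_lin// mul0r addr0.
  have -> : sqnorm b * rint (fun v => F (v - u)) =
      rint (fun v => sqnorm b * F (v - u) + 0 * F (v - u)).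
    by rewrite rint_lin// mul0r addr0.
  apply: (eq_rint_off_null mD) => //.
  - by apply: meas_RnD; apply: meas_RnM => //; exact: meas_Rn_cst.
  - by apply: meas_RnD; apply: meas_RnM => //; exact: meas_Rn_cst.
  - by move=> v /FD; rewrite !mul0r !addr0.
(* This is the parallelogram law for 1 and [nu]; with the previous equality it gives [b] squared
   modulus 2, hence [b != 0]. *)
have ab4 : sqnorm a + sqnorm b = 4.
  have : sqnorm nu = 1 by apply: complexI; rewrite add_Re2_Im2 nu1 expr1n.
  rewrite /a /b; case: (nu) => p q; rewrite /sqnorm /= => pq.
  rewrite [RHS](_ : _ = 2 + 2 * (p ^+ 2 + q ^+ 2)); last by rewrite pq; ring.
  by ring.
have b0 : b != 0 by rewrite -sqnorm_eq0; apply/eqP; lra.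
have FDu v : D v = 0 -> F (v - u) = F v.
  have b2 : sqnorm b != 0 by rewrite sqnorm_eq0.
  by move=> /FD; rewrite ab => /(mulfI b2).
have [uE|u0] := eqVneq u 0; last first.
  by move/eqP: N0; apply; exact: (rint_translation_invariant_eq0 u0 mD D0 iD iF F0 FDu).
(* With [u = 0] the relation factors as (a + b exp(2 pi i eta.v)) g(-v) = 0, so off the null set [F]
   lives on the hyperplanes where eta.v lies in the countable set [C]. *)
move: p0; rewrite uE eqxx /= => eta0.
have cC := countable_expi_eq a b0.
set C := [set s | _] in cC.
have mC : measurable (C : set (measurableTypeR R)).
  by apply: countable_measurable => // t; exact: measurable_set1.
have mchi : meas_Rn (fun v => F v * \1_C (dotv eta v)).
  apply: meas_RnM => //.
  exact: (measurableT_comp (measurable_indic mC) (meas_Rn_dotv eta)).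
move/eqP: N0; apply.
rewrite (eq_rint_off_null mD D0 iD mF mchi); last first.
  move=> v; rewrite DE uE /tfrefl => /eqP; rewrite sqnorm_eq0.
  rewrite (dotvC eta 0) !dotv0l mulr0 !subr0 mulr0 expi0 mul1r !sub0r.
  rewrite [pi * _]mulrA [pi * 2]mulrC mulrA -mulrDl mulf_eq0 => /orP[/eqP Cv|/eqP gv].
    by rewrite indicE mem_set ?mulr1.
  by rewrite /F sub0r gv /sqnorm /= expr0n addr0 mul0r.
rewrite /rint (iint_countable_hyperplanes (b := 0) eta0 cC (emeas_EFin mchi))//.
by move=> v; rewrite addr0 => nC; rewrite indicE memNset// mulr0.
Qed.

End Independence.

(** * Lattices and the symplectic form *)

Section SymplecticForm.
Set Implicit Arguments.
Unset Strict Implicit.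
Context {R : realType}.

Lemma dotv_trmx n (a b : 'cV[R]_n) : (a^T *m b) 0 0 = dotv a b.
Proof. by rewrite mxE; apply: eq_bigr => i _; rewrite mxE. Qed.

(** The bracket of [a] and [b] is minus a^T J b, so the defining relation of a symplectic matrix
    applies directly. *)
Lemma symplectic_dotv d (S : 'M[R]_(d + d)) (z z' : 'cV[R]_(d + d)) :
  symplectic S ->
  dotv (usubmx (S *m z)) (dsubmx (S *m z')) - dotv (dsubmx (S *m z)) (usubmx (S *m z')) =
  dotv (usubmx z) (dsubmx z') - dotv (dsubmx z) (usubmx z').
Proof.
move=> [_ SJ].
have form (a b : 'cV[R]_(d + d)) :
    dotv (usubmx a) (dsubmx b) - dotv (dsubmx a) (usubmx b) =
    - (a^T *m Jmx R d *m b) 0 0.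
  rewrite -[in RHS](vsubmxK a) -[in RHS](vsubmxK b) tr_col_mx /Jmx.
  rewrite mul_row_block !mulmx0 !mulmx1 add0r addr0 mulmxN mulmx1.
  by rewrite mul_row_col mulNmx mxE [X in - (_ + X)]mxE !dotv_trmx opprD opprK addrC.
rewrite !form trmx_mul; congr (- (_ 0 0)).
by rewrite -!mulmxA [S^T *m _]mulmxA [_ *m (S *m z')]mulmxA SJ.
Qed.

(** The first vector of the dual basis solves M^T m = e_0, so pairing it with [M k] returns the
    first entry of [k]. Positivity of [d] ensures that this entry exists. *)
Lemma dual_vector d (M : 'M[R]_d) : (0 < d)%N -> M \in unitmx ->
  exists2 m : 'cV[R]_d, m != 0 &
    forall k : 'cV[int]_d, exists j : int, dotv (M *m intvec R k) m = j%:~R.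
Proof.
case: d M => // d M _ uM.
pose e : 'cV[R]_d.+1 := delta_mx 0 0.
have MK : M^T *m (invmx M^T *m e) = e by rewrite mulKVmx// unitmx_tr.
exists (invmx M^T *m e).
  apply/eqP => m0; move: MK; rewrite m0 mulmx0 => /matrixP/(_ 0 0).
  by rewrite !mxE !eqxx => /eqP; rewrite eq_sym oner_eq0.
move=> k; exists (k 0 0).
rewrite -dotv_trmx trmx_mul -mulmxA MK dotv_trmx /dotv (bigD1 0)//= big1 => [|i i0].
  by rewrite !mxE !eqxx mulr1 addr0.
by rewrite !mxE (negbTE i0) mulr0.
Qed.

End SymplecticForm.

(** * Construction of the two functions from the symplectic data *)

Theorem theorem1p1 (R : realType) (d : nat) (Lset : set 'cV[R]_(d + d)) :
  (0 < d)%N ->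
  ((exists (S : 'M[R]_(d + d)) (Lam : set 'cV[R]_d),
      [/\ symplectic S, is_lattice Lam &
          Lset = [set S *m col_mx x l | x in [set: 'cV[R]_d] & l in Lam]])
   \/
   (exists (S : 'M[R]_(d + d)) (A B : 'M[R]_d),
      [/\ symplectic S, A \in unitmx, B \in unitmx &
          Lset = latt (S *m block_mx A 0 0 B)])) ->
  forall g : 'cV[R]_d -> R[i], L2 g ->
  exists f1 f2 : 'cV[R]_d -> R[i],
    [/\ L2 f1, L2 f2,
        (forall z, Lset z -> `|stftz g f1 z| = `|stftz g f2 z|) &
        ~ (exists nu : R[i], `|nu| = 1 /\ L2_eq f1 (fun t => nu * f2 t))].
Proof.
move=> d0 hL g Lg.
(* Both cases place [Lset] inside the image under [S] of R^d times a lattice; in the second case the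
   lattice is generated by [B] and [A] is forgotten. *)
have [S [M [Ssp uM LS]]] : exists (S : 'M[R]_(d + d)) (M : 'M[R]_d),
    [/\ symplectic S, M \in unitmx & forall z, Lset z ->
        exists x k, z = S *m col_mx x (M *m intvec R k)].
  case: hL => [[S [Lam [Ssp [M uM LamE] LE]]]|[S [A [B [Ssp uA uB LE]]]]].
    exists S, M; split => // z; rewrite LE => -[x _ [l]].
    by rewrite LamE => -[k _ <-] <-; exists x, k.
  exists S, B; split => // z; rewrite LE => -[k _ <-].
  exists (A *m intvec R (usubmx k)), (dsubmx k).
  rewrite -mulmxA; congr (_ *m _); rewrite -[in LHS](vsubmxK k) /intvec map_col_mx.
  by rewrite mul_block_col !mul0mx addr0 add0r.
(* A null window annihilates everything, so a unit-norm function and 0 already have equal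
   transforms. *)
have [g0|g0] := pselect (iint (fun t => (sqnorm (g t))%:E) = 0%E).
  have [f Lf f1] := @exists_L2_norm1 R d.
  have L0 : L2 (fun _ : 'cV[R]_d => 0 : R[i]).
    split; first exact: cmeasurable_cst.
    under eq_fun do rewrite /sqnorm /= expr0n addr0.
    by rewrite iint_cst0 ltry.
  exists f, (fun=> 0); split => // [z _|[nu [_]]].
    by rewrite /stftz !stft_null_window.
  rewrite /L2_eq; under eq_fun do rewrite mulr0 subr0.
  by rewrite f1 => /eqP; rewrite onee_eq0.
have [m m0 hm] := dual_vector d0 uM.
pose p : 'cV[R]_(d + d) := S *m col_mx m 0.
pose u := usubmx p; pose eta := dsubmx p.
(* Invertibility of [S] carries [m != 0] over to the shift [p]. *)
have p0 : (u != 0) || (eta != 0).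
  rewrite -negb_and; apply: contra m0 => /andP[/eqP u0 /eqP e0].
  have : p = 0 by rewrite -[p]vsubmxK -/u -/eta u0 e0 col_mx0.
  move=> /(congr1 (mulmx (invmx S))); rewrite mulKmx ?mulmx0; last exact: Ssp.1.
  by rewrite -[X in _ = X]col_mx0 => /eq_col_mx[-> _].
have L0 := L2_tfrefl 0 0 Lg; have L1 := L2_tfrefl u eta Lg.
have Lc (c : R[i]) : L2 (fun t => tfrefl g 0 0 t + c * tfrefl g u eta t).
  by apply: L2D => //; exact: (L2M L1 (cmeasurable_cst _ c) (fun=> erefl)).
exists (fun t => tfrefl g 0 0 t + (0 +i* 1)%C * tfrefl g u eta t),
  (fun t => tfrefl g 0 0 t + - (0 +i* 1)%C * tfrefl g u eta t).
split => //; last exact: tfrefl_independent.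
move=> z /LS[x [k zE]].
have [j hj] := hm k.
rewrite /stftz !stft_lin//.
(* The conjugation factor depends on [z] alone, so it is common to both transforms. The bracket of
   [z] with the shift is 0 for the unshifted window, and for the other one it is minus the pairing
   of the lattice vector with [m], hence [- j]. *)
apply: (@normc_eq_of_conj _ _ _ (expi (2 * pi * dotv (dsubmx z) (usubmx z)))).
  apply: (@conjc_stft_tfrefl _ _ _ _ _ _ _ 0) => //.
  by rewrite dotv0l dotvC dotv0l subr0.
apply: (@conjc_stft_tfrefl _ _ _ _ _ _ _ (- j)) => //.
rewrite dotvC zE /u /eta (symplectic_dotv _ _ Ssp) !col_mxKu !col_mxKd.
by rewrite dotvC dotv0l sub0r hj mulrNz.
Qed.
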